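(* Let $\mu$ be a finite measure on the Borel $\sigma$-algebra of the unit circle $\mathbb{T}$. If $\mu$ is continuous, then the position operator $U_{\varphi,\mu}$ on $L^2(\mathbb{T},\mu)$ is weakly quasistable.
   Context: All measures are positive. A measure on $\mathbb{T}$ is continuous if every singleton has measure zero. The position operator $U_{\varphi,\mu}$ on the complex Hilbert space $L^2(\mathbb{T},\mu)$ is the multiplication operator $(U_{\varphi,\mu}\psi)(z)=z\,\psi(z)$ $\mu$-a.e. for $z\in\mathbb{T}$, for every $\psi\in L^2(\mathbb{T},\mu)$; it is unitary. An operator $T$ on a Hilbert space $\mathcal{H}$ with inner product $\langle\cdot\,;\cdot\rangle$ is weakly quasistable if for each $x\in\mathcal{H}$ there exists a strictly increasing sequence $\{n_j\}=\{n_j(x)\}$ of positive integers (which may depend on $x$ but not on $y$) such that $\lim_j|\langle T^{n_j}x\,;y\rangle|=0$ for every $y\in\mathcal{H}$. *)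

(* Defs.v *)
From HB Require Import structures.
From mathcomp Require Import all_boot all_order all_algebra.
From mathcomp Require Import all_classical all_reals all_analysis.
From mathcomp Require Import measurable_realfun.
From mathcomp Require Import sesquilinear ring lra complex.

Set Implicit Arguments.
Unset Strict Implicit.
Unset Printing Implicit Defensive.

Import Order.TTheory GRing.Theory Num.Theory.
Import numFieldNormedType.Exports.

Local Open Scope classical_set_scope.
Local Open Scope ring_scope.
Local Open Scope complex_scope.
Local Open Scope quotient_scope.

Local Notation cRe := complex.Re.
Local Notation cIm := complex.Im.

HB.instance Definition _ (R : realType) := NormedModule.copy R[i] R[i]^o.

(* [V] with [dot] is a complex inner product space; completeness plays no role
   in the definition. The form is linear in its first argument. *)
Definition weakly_quasistable (R : realType) (V : lmodType R[i])
    (dot : {dot V for @Num.conj R[i]}) (T : {linear V -> V}) : Prop :=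
  forall x : V, exists n : nat -> nat,
    [/\ forall j, (0 < n j)%N,
        {homo n : i j / (i < j)%N} &
        forall y : V,
          (fun j => `|dot (iter (n j) T x) y|) @ \oo --> (0 : R[i])].

Section complex_L2.
Context d (T : measurableType d) (R : realType).
Variable mu : {measure set T -> \bar R}.
Implicit Types f g : T -> R[i].

(* Measurability and integration of complex-valued functions are componentwise;
   [Normc.normc] is the modulus with values in [R]. *)
Definition cmeasurable f : Prop :=
  measurable_fun setT (fun x => cRe (f x)) /\
  measurable_fun setT (fun x => cIm (f x)).

Definition cintegral f : R[i] :=
  (\int[mu]_x cRe (f x))%R +i* (\int[mu]_x cIm (f x))%R.

Definition L2pred : {pred T -> R[i]} := fun f =>
  `[< cmeasurable f /\
      (\int[mu]_x (Normc.normc (f x) ^+ 2)%:E < +oo)%E >].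

Lemma sqr_normcE (z : R[i]) : Normc.normc z ^+ 2 = cRe z ^+ 2 + cIm z ^+ 2.
Proof. by case: z => a b /=; rewrite sqr_sqrtr// addr_ge0// sqr_ge0. Qed.

Let Lfun2P (h : T -> R) : h \in Lfun mu 2%:E <->
  measurable_fun setT h /\ (\int[mu]_x (h x ^+ 2)%:E < +oo)%E.
Proof.
split=> [hL|[mh ih]].
  have mh : measurable_fun setT h.
    by move: hL; rewrite inE => /andP[/[!inE]].
  split=> //; have /integrableP[_] := Lfun2_integrable_sqr hL.
  by under eq_integral => x _ do rewrite /= ger0_norm ?sqr_ge0//.
rewrite inE; apply/andP; split; rewrite inE//=.
rewrite /finite_norm unlock poweR_lty//.
under eq_integral => x _ do rewrite /= powR_mulrn// real_normK ?num_real//.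
exact: ih.
Qed.

Lemma L2predP f : f \in L2pred <->
  (fun x => cRe (f x)) \in Lfun mu 2%:E /\
  (fun x => cIm (f x)) \in Lfun mu 2%:E.
Proof.
have mX (h : T -> R) : measurable_fun setT h ->
    measurable_fun setT (fun x => (h x ^+ 2)%:E).
  by move=> mh; apply/measurable_EFinP; exact: measurable_funX.
have X0 (h : T -> R) x : setT x -> (0 <= (h x ^+ 2)%:E)%E.
  by move=> _; rewrite lee_fin sqr_ge0.
have intE : cmeasurable f -> (\int[mu]_x (Normc.normc (f x) ^+ 2)%:E =
    \int[mu]_x (cRe (f x) ^+ 2)%:E + \int[mu]_x (cIm (f x) ^+ 2)%:E)%E.
  move=> [mr mi]; rewrite -ge0_integralD//; last 4 first.
  - exact: X0.
  - exact: mX.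
  - exact: X0.
  - exact: mX.
  by apply: eq_integral => x _; rewrite sqr_normcE.
have i0 (h : T -> R) : (0 <= \int[mu]_x (h x ^+ 2)%:E)%E.
  by apply: integral_ge0 => x; exact: X0.
rewrite unfold_in asboolE !Lfun2P; split=> [[mf]|[[mr ir] [mi ii]]].
  rewrite intE// => fi; have [mr mi] := mf.
  by split; split=> //; apply: le_lt_trans fi; [exact: leeDl|exact: leeDr].
by split=> //; rewrite intE// lte_add_pinfty.
Qed.

Lemma L2pred_submod_closed : submod_closed L2pred.
Proof.
have [L0 LS] := @Lfun_submod_closed _ T R mu 2%:E (lee1n 2).
split; first by apply/L2predP; split; exact: L0.
move=> a f g /L2predP[fr fi] /L2predP[gr gi]; apply/L2predP; split.
- rewrite (_ : (fun x => _) = cRe a *: (fun x => cRe (f x) : R) +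
    (- cIm a *: (fun x => cIm (f x) : R) + (fun x => cRe (g x)))).
    exact/LS/LS.
  apply/funext => x; rewrite !fctE /=.
  by case: a (f x) (g x) => [a b] [u v] [s t] /=; rewrite /GRing.scale/=; ring.
- rewrite (_ : (fun x => _) = cRe a *: (fun x => cIm (f x) : R) +
    (cIm a *: (fun x => cRe (f x) : R) + (fun x => cIm (g x)))).
    exact/LS/LS.
  apply/funext => x; rewrite !fctE /=.
  by case: a (f x) (g x) => [a b] [u v] [s t] /=; rewrite /GRing.scale/=; ring.
Qed.

HB.instance Definition _ :=
  GRing.isSubmodClosed.Build _ _ L2pred L2pred_submod_closed.

Record L2fun := MkL2fun { L2fun_val :> T -> R[i]; _ : L2fun_val \in L2pred }.

HB.instance Definition _ := [isSub for L2fun_val].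
HB.instance Definition _ := [Choice of L2fun by <:].
HB.instance Definition _ := [SubChoice_isSubLmodule of L2fun by <:].

Definition L2null : {pred L2fun} :=
  fun h => `[< {ae mu, forall x, h x = 0} >].

Lemma L2null_submod_closed : submod_closed L2null.
Proof.
split; first by apply/asboolP; apply: aeW.
move=> a f g /asboolP f0 /asboolP g0; apply/asboolP.
by apply: filterS2 f0 g0 => x /= fx gx; rewrite !fctE fx gx scaler0 addr0.
Qed.

HB.instance Definition _ :=
  GRing.isSubmodClosed.Build _ _ L2null L2null_submod_closed.

(* Square-integrable functions modulo equality almost everywhere. *)
Definition L2 := Quotient.quot L2null.

HB.instance Definition _ := GRing.Zmodule.on L2.
HB.instance Definition _ := EqQuotient.on L2.

Implicit Types (u v w : L2) (h k : L2fun).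

Lemma pi_L2P h k : \pi_L2 h = \pi_L2 k <-> {ae mu, forall x, h x = k x}.
Proof.
rewrite (rwP eqP) -Quotient.idealrBE unfold_in asboolE.
by split; apply: filterS => x /eqP hk; apply/eqP; move: hk; rewrite subr_eq0.
Qed.

Lemma repr_L2P u v : u = v <-> {ae mu, forall x, repr u x = repr v x}.
Proof. by rewrite -pi_L2P !reprK. Qed.

Lemma repr_pi_L2 h : {ae mu, forall x, repr (\pi_L2 h) x = h x}.
Proof. by apply/pi_L2P; rewrite reprK. Qed.

Definition L2scale (a : R[i]) u : L2 := \pi_L2 (a *: repr u).

Lemma pi_L2Z a h : \pi_L2 (a *: h) = L2scale a (\pi_L2 h).
Proof.
apply/pi_L2P; have := repr_pi_L2 h; apply: filterS => x /= E.
by rewrite !fctE E.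
Qed.

Lemma pi_L2D h k : \pi_L2 (h + k) = \pi_L2 h + \pi_L2 k.
Proof. by rewrite !piE. Qed.

Fact L2scaleA a b u : L2scale a (L2scale b u) = L2scale (a * b) u.
Proof.
by rewrite -[u]reprK -(pi_L2Z b) -(pi_L2Z a) -(pi_L2Z (a * b)) scalerA.
Qed.

Fact L2scale1 : left_id 1 L2scale.
Proof. by move=> u; rewrite -[u]reprK -pi_L2Z scale1r. Qed.

Fact L2scaleDr : right_distributive L2scale +%R.
Proof.
move=> a u v; rewrite -[u]reprK -[v]reprK -pi_L2D.
rewrite -(pi_L2Z a) -(pi_L2Z a (repr u)) -(pi_L2Z a (repr v)).
by rewrite -pi_L2D scalerDr.
Qed.

Fact L2scaleDl u : {morph L2scale^~ u : a b / a + b}.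
Proof.
move=> a b; rewrite -[u]reprK.
by rewrite -(pi_L2Z a) -(pi_L2Z b) -(pi_L2Z (a + b)) -pi_L2D scalerDl.
Qed.

HB.instance Definition _ := GRing.Zmodule_isLmodule.Build R[i] L2
  L2scaleA L2scale1 L2scaleDr L2scaleDl.

Definition cintegrable f : Prop :=
  mu.-integrable setT (fun x => (cRe (f x))%:E) /\
  mu.-integrable setT (fun x => (cIm (f x))%:E).

Lemma cintegralD f g : cintegrable f -> cintegrable g ->
  cintegral (fun x => f x + g x) = cintegral f + cintegral g.
Proof.
move=> [fr fi] [gr gi]; rewrite /cintegral.
have rD x : cRe (f x + g x) = cRe (f x) + cRe (g x)
  by case: (f x) (g x) => [? ?] [].
have iD x : cIm (f x + g x) = cIm (f x) + cIm (g x)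
  by case: (f x) (g x) => [? ?] [].
under eq_Rintegral do rewrite rD.
under [in X in _ +i* X]eq_Rintegral do rewrite iD.
by rewrite !RintegralD.
Qed.

Lemma cintegralZ a f : cintegrable f ->
  cintegral (fun x => a * f x) = a * cintegral f.
Proof.
case: a => a b [fr fi]; rewrite /cintegral.
have rM x : cRe ((a +i* b) * f x) = a * cRe (f x) - b * cIm (f x)
  by case: (f x).
have iM x : cIm ((a +i* b) * f x) = a * cIm (f x) + b * cRe (f x)
  by case: (f x).
have iZ c (h : T -> R) : mu.-integrable setT (fun x => (h x)%:E) ->
    mu.-integrable setT (fun x => (c * h x)%:E).
  by move=> ih; under eq_fun do rewrite EFinM; exact: integrableZl.
under eq_Rintegral do rewrite rM.
under [in X in _ +i* X]eq_Rintegral do rewrite iM.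
rewrite RintegralB// ?RintegralD// ?RintegralZl//; exact: iZ.
Qed.

Lemma cintegral_conj f : cintegrable f ->
  cintegral (fun x => (f x)^*) = (cintegral f)^*.
Proof.
move=> [fr fi]; rewrite /cintegral /=.
have rM x : cRe ((f x)^*) = cRe (f x) by case: (f x).
have iM x : cIm ((f x)^*) = (-1) * cIm (f x)
  by case: (f x) => ? ?; rewrite mulN1r.
under eq_Rintegral do rewrite rM.
under [in X in _ +i* X]eq_Rintegral do rewrite iM.
by rewrite RintegralZl// mulN1r.
Qed.

Lemma ae_eq_cintegral f g : cintegrable f -> cintegrable g ->
  {ae mu, forall x, f x = g x} -> cintegral f = cintegral g.
Proof.
move=> [/integrableP[fr _] /integrableP[fi _]].
move=> [/integrableP[gr _] /integrableP[gi _]] fg.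
rewrite /cintegral /Rintegral; congr (fine _ +i* fine _);
  apply: ae_eq_integral => //; by apply: filterS fg => x /= ->.
Qed.

Lemma cintegrable_L2 h k : cintegrable (fun x => h x * (k x)^*).
Proof.
have [/L2predP[hr hi] /L2predP[kr ki]] := (valP h, valP k).
have iM (p q : T -> R) : p \in Lfun mu 2%:E -> q \in Lfun mu 2%:E ->
    mu.-integrable setT (fun x => (p x * q x)%:E).
  by move=> pL qL; exact/Lfun1_integrable/Lfun2_mul_Lfun1.
have rM x : cRe (h x * (k x)^*) = cRe (h x) * cRe (k x) + cIm (h x) * cIm (k x).
  by case: (h x) (k x) => [? ?] [? ?] /=; ring.
have jM x : cIm (h x * (k x)^*) = cIm (h x) * cRe (k x) - cRe (h x) * cIm (k x).
  by case: (h x) (k x) => [? ?] [? ?] /=; ring.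
split.
  under eq_fun do rewrite rM EFinD.
  by apply: integrableD => //; exact: iM.
under eq_fun do rewrite jM EFinB.
by apply: integrableB => //; exact: iM.
Qed.

Definition L2dot u v : R[i] := cintegral (fun x => repr u x * (repr v x)^*).

Lemma L2dot_pi h k :
  L2dot (\pi_L2 h) (\pi_L2 k) = cintegral (fun x => h x * (k x)^*).
Proof.
apply: ae_eq_cintegral; do ?exact: cintegrable_L2.
by have := repr_pi_L2 k; have := repr_pi_L2 h; apply: filterS2 => x -> ->.
Qed.

Lemma L2dotC u v : L2dot u v = (L2dot v u)^*.
Proof.
rewrite /L2dot -cintegral_conj; last exact: cintegrable_L2.
by congr cintegral; apply/funext => x; rewrite rmorphM /= conjcK mulrC.
Qed.

Lemma L2dot_linearl v : GRing.linear_for *%R (L2dot^~ v).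
Proof.
move=> a u w; rewrite -[u]reprK -[v]reprK -[w]reprK.
rewrite -[a *: _]pi_L2Z -pi_L2D !L2dot_pi.
rewrite -cintegralZ; last exact: cintegrable_L2.
rewrite -cintegralD; do ?exact: cintegrable_L2.
  congr cintegral; apply/funext => x.
  by rewrite mulrA -mulrDl.
have := cintegrable_L2 (a *: repr u) (repr v); congr cintegrable.
by apply/funext => x; rewrite mulrA.
Qed.

Lemma L2dot_linearr u : GRing.linear_for (@Num.conj R[i] \; *%R) (L2dot u).
Proof.
move=> a v w; rewrite L2dotC L2dot_linearl rmorphD rmorphM /=.
by rewrite (L2dotC u v) (L2dotC u w).
Qed.

HB.instance Definition _ := bilinear_isBilinear.Build R[i] L2 L2 R[i] _ _ L2dot
  (L2dot_linearl, L2dot_linearr).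

Fact L2dot_hermitian u v : L2dot u v = (-1) ^+ false * Num.conj (L2dot v u).
Proof. by rewrite expr0 mul1r L2dotC. Qed.

HB.instance Definition _ := isHermitianSesquilinear.Build R[i] L2 false
  (@Num.conj R[i]) L2dot L2dot_hermitian.

Lemma L2dotxx u :
  L2dot u u = (\int[mu]_x (Normc.normc (repr u x) ^+ 2))%R%:C.
Proof.
rewrite /L2dot /cintegral; congr (_ +i* _).
  apply: eq_Rintegral => x _; rewrite sqr_normcE.
  by case: (repr u x) => a b /=; ring.
rewrite (@eq_Rintegral _ _ _ mu _ (cst 0)) /Rintegral ?integral0// => x _.
by case: (repr u x) => a b /=; ring.
Qed.

Lemma L2dot_gt0 u : u != 0 -> 0 < L2dot u u.
Proof.
move=> u0; rewrite L2dotxx ltcR lt_neqAle.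
rewrite Rintegral_ge0 ?andbT; last by move=> x _; exact: sqr_ge0.
apply: contra u0 => /eqP/esym.
have /asboolP[[mr mi] fin] := valP (repr u).
have i0 : (0 <= \int[mu]_x (Normc.normc (repr u x) ^+ 2)%:E)%E.
  by apply: integral_ge0 => x _; rewrite lee_fin sqr_ge0.
rewrite /Rintegral => /eqP; rewrite fine_eq0 ?ge0_fin_numE// => /eqP int0.
have mf : measurable_fun setT (fun x => (Normc.normc (repr u x) ^+ 2)%:E).
  apply/measurable_EFinP; under eq_fun do rewrite sqr_normcE.
  by apply: measurable_funD; exact: measurable_funX.
have [+ _] := ae_eq_integral_abs mu measurableT mf.
under eq_integral do rewrite gee0_abs ?lee_fin ?sqr_ge0//.
move=> /(_ int0) ae0; have z0 : 0 = \pi_L2 0 :> L2 by rewrite piE.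
rewrite -[u]reprK z0; apply/eqP/pi_L2P; move: ae0; apply: filterS => x.
move=> /(_ I) /eqP; rewrite eqe sqrf_eq0 => /eqP.
exact: Normc.eq0_normc.
Qed.

HB.instance Definition _ := isDotProduct.Build R[i] L2 L2dot L2dot_gt0.

End complex_L2.

Arguments L2dot {d T R} mu.

(* The type of points of the unit circle, with the topology induced by R[i] and
   the Borel sigma-algebra of that topology. *)
Definition circle (R : realType) : Type := [set z : R[i] | `|z| = 1].

HB.instance Definition _ (R : realType) := Topological.on (circle R).
HB.instance Definition _ (R : realType) :=
  isPointed.Build (circle R) (exist _ 1 (mem_set (normr1 R[i]))).
HB.instance Definition _ (R : realType) :=
  Measurable.copy (circle R) (g_sigma_algebraType (@open (circle R))).

Section position_operator.
Context (R : realType).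

Definition circle_val (z : circle R) : R[i] := \val z.

Lemma circle_val_norm (z : circle R) : Normc.normc (circle_val z) = 1.
Proof.
have : `|circle_val z| = 1 := set_mem (valP z).
by rewrite normc_def; case: (circle_val z) => a b [].
Qed.

Lemma open_measurable_circle (A : set (circle R)) : open A -> measurable A.
Proof. by move=> oA; exact: sub_sigma_algebra. Qed.

Lemma circle_val_continuous : continuous circle_val.
Proof. exact: initial_continuous. Qed.

Lemma measurable_circle (h : circle R -> R) :
  continuous h -> measurable_fun setT h.
Proof.
move=> /continuousP ch; apply: (measurability (@RGenOInfty.G R)).
  exact: RGenOInfty.measurableE.
move=> _ [_ [x ->] <-]; rewrite setTI set_itvE.
by apply: open_measurable_circle; apply: ch; exact: open_gt.
Qed.

Lemma cmeasurable_circle_val : cmeasurable circle_val.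
Proof.
have ReIm_continuous (p : R[i] -> R) : (forall z w, p z - p w = p (z - w)) ->
    (forall z, `|p z|%:C <= `|z|) -> continuous p.
  move=> pB ple z; apply/(@cvgrPdist_lt _ _ _ (nbhs z) (nbhs_filter z)) => e e0.
  exists e%:C => [|w /= zw]; first by rewrite /= ltcR.
  by rewrite pB -ltcR; exact: le_lt_trans (ple _) zw.
split; apply: measurable_circle => z; apply: continuous_comp;
    [exact: circle_val_continuous| |exact: circle_val_continuous|];
    apply: ReIm_continuous => [[a b] [c e]//|[a b]].
- exact: normc_ge_Re.
- rewrite normc_def lecR -[leLHS]sqrtr_sqr.
  by rewrite ler_sqrt ?lerDr ?sqr_ge0// addr_ge0 ?sqr_ge0.
Qed.

Definition continuous_measure (mu : set (circle R) -> \bar R) : Prop :=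
  forall z, mu [set z] = 0%E.

Variable mu : {measure set (circle R) -> \bar R}.

Lemma position_subproof (f : L2fun mu) :
  (fun z => circle_val z * f z) \in L2pred mu.
Proof.
have [zr zi] := cmeasurable_circle_val.
have /asboolP[[fr fi] ffin] := valP f; apply/asboolP; split.
  have rM x : cRe (circle_val x * f x) =
      cRe (circle_val x) * cRe (f x) - cIm (circle_val x) * cIm (f x).
    by case: (circle_val x) (f x) => [? ?] [? ?].
  have iM x : cIm (circle_val x * f x) =
      cRe (circle_val x) * cIm (f x) + cIm (circle_val x) * cRe (f x).
    by case: (circle_val x) (f x) => [? ?] [? ?].
  split.
    under eq_fun do rewrite rM.
    by apply: measurable_funB; exact: measurable_funM.
  under eq_fun do rewrite iM.
  by apply: measurable_funD; exact: measurable_funM.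
by under eq_integral do rewrite Normc.normcM circle_val_norm mul1r.
Qed.

Definition position_op (u : L2 mu) : L2 mu :=
  \pi_(L2 mu) (MkL2fun (position_subproof (repr u))).

Lemma position_opE u :
  {ae mu, forall z, repr (position_op u) z = circle_val z * repr u z}.
Proof. exact: repr_pi_L2. Qed.

Fact position_op_linear : linear position_op.
Proof.
move=> a u v; rewrite -[a *: position_op u]pi_L2Z.
rewrite -pi_L2D; apply/pi_L2P.
have := repr_pi_L2 (a *: repr u + repr v).
rewrite pi_L2D pi_L2Z !reprK; apply: filterS => z /= ->.
by rewrite mulrDr mulrCA.
Qed.

HB.instance Definition _ :=
  GRing.isLinear.Build R[i] (L2 mu) (L2 mu) _ position_op position_op_linear.

Lemma position_op_isometry u v :
  L2dot mu (position_op u) (position_op v) = L2dot mu u v.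
Proof.
rewrite L2dot_pi; congr cintegral; apply/funext => z /=.
have E : `|circle_val z| = 1 := set_mem (valP z).
by rewrite rmorphM mulrACA -sqr_normc E expr1n mul1r.
Qed.

End position_operator.

Arguments position_op {R} mu u.

(* Main.v *)
Require Import Defs.
From HB Require Import structures.
From mathcomp Require Import all_boot all_order all_algebra.
From mathcomp Require Import all_classical all_reals all_analysis.
From mathcomp Require Import measurable_realfun.
From mathcomp Require Import sesquilinear ring lra complex.

(** For a given vector [x], the vectors [z^n x] become nearly orthogonal to one
    another along a suitable sequence of exponents, and a bounded sequence of
    nearly orthogonal vectors converges weakly to zero.

    Let [U] be the position operator and [nu] the finite measure
    with density [|x|^2] with respect to [mu]. Then [<U^n x, x>] is the Fourier
    coefficient [c n], the integral of [z^n] against [nu], and Wiener's lemma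
    holds for the continuous measure [nu]: the Cesaro means of [|c n|^2] tend
    to zero ([wiener_cvg0]). No product measure is needed for it. For fixed
    [v] on the circle, the means [K N v z] of the powers [(z v^* )^i], [i <= N],
    are bounded by 1 and tend to 0 for [z <> v], hence almost everywhere, so by
    dominated convergence [G N v], the integral of [K N v] against [nu], tends
    to 0 for every [v]. A second use of dominated convergence shows that the
    integral of [G N] against [nu] tends to 0; as [G N v] is the mean of the
    [c i * v^* ^i], this integral is the mean of the [|c i|^2].

    If the Cesaro means of a nonnegative sequence tend to zero, arbitrarily far
    out there are windows of any given length on which the sequence is small
    ([cesaro_cvg0_window]). As [U] is an isometry, [<U^n x, U^k x>] has modulus
    [|c (n - k)|], so exponents [n_0 < n_1 < ...] can be chosen one at a time
    with [|<U^(n_k) x, U^(n_j) x>| <= 1 / (j + 1)^2] for [k < j].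

    Finally ([almost_orthogonal_cvg0]) let [x_j] be bounded with these almost
    orthogonality relations, and subtract from a vector [y] in turn a fixed
    multiple [t] of its components along the [x_j]. Each step lowers the squared
    norm of the remainder by at least [t |d_j|^2], where [d_j] is the product of
    the remainder with [x_j]; hence [d_j] tends to 0, and [<y, x_j>] differs
    from [d_j] by [O(1 / j)]. The exponents do not depend on [y], and neither
    separability nor completeness of the space plays a role. *)

Set Implicit Arguments.
Unset Strict Implicit.
Unset Printing Implicit Defensive.

Import Order.TTheory GRing.Theory Num.Theory.
Import numFieldNormedType.Exports.
Local Open Scope classical_set_scope.
Local Open Scope ring_scope.
Local Open Scope complex_scope.

Local Notation cRe := complex.Re.
Local Notation cIm := complex.Im.
Local Notation normc := Normc.normc.

(** * The modulus of a complex number *)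

Lemma normcE_norm (R : realType) (z : R[i]) : `|z| = (normc z)%:C.
Proof. by case: z => a b; rewrite normc_def. Qed.

Lemma normc_ge0 (R : realType) (z : R[i]) : 0 <= normc z.
Proof. by case: z => a b; exact: sqrtr_ge0. Qed.

Lemma normc_sqr_conj (R : realType) (z : R[i]) : (normc z ^+ 2)%:C = z * z^*.
Proof. by rewrite rmorphXn /= -normcE_norm sqr_normc. Qed.

Lemma normc_real (R : realType) (a : R) : normc a%:C = `|a|.
Proof. by rewrite /= expr0n addr0 sqrtr_sqr. Qed.

Lemma normc_conj (R : realType) (z : R[i]) : normc z^* = normc z.
Proof. by case: z => a b; rewrite /= sqrrN. Qed.

Lemma normcX (R : realType) (z : R[i]) n : normc (z ^+ n) = normc z ^+ n.
Proof.
by elim: n => [|n ih]; rewrite ?Normc.normc1// !exprS Normc.normcM ih.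
Qed.

Lemma normcD_le (R : realType) (z w : R[i]) :
  normc (z + w) <= normc z + normc w.
Proof. by rewrite -lecR rmorphD /= -!normcE_norm ler_normD. Qed.

Lemma normc_sum (R : realType) n (f : nat -> R[i]) :
  normc (\sum_(i < n) f i) <= \sum_(i < n) normc (f i).
Proof.
elim: n => [|n ih]; first by rewrite !big_ord0 Normc.normc0.
by rewrite !big_ord_recr /= (le_trans (normcD_le _ _))// lerD2r.
Qed.

Lemma norm_Re_le (R : realType) (z : R[i]) : `|cRe z| <= normc z.
Proof. by rewrite -lecR -normcE_norm normc_ge_Re. Qed.

Lemma norm_Im_le (R : realType) (z : R[i]) : `|cIm z| <= normc z.
Proof.
case: z => a b /=; rewrite -[leLHS]sqrtr_sqr ler_sqrt ?lerDr ?sqr_ge0//.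
by rewrite addr_ge0 ?sqr_ge0.
Qed.

Lemma normc_le_ReIm (R : realType) (z : R[i]) : normc z <= `|cRe z| + `|cIm z|.
Proof.
case: z => a b; rewrite -(@ler_pXn2r _ 2) ?nnegrE ?normc_ge0 ?addr_ge0//.
rewrite sqr_normcE /= -(real_normK (num_real a)) -(real_normK (num_real b)).
by have := mulr_ge0 (normr_ge0 a) (normr_ge0 b); nra.
Qed.

Lemma normc_mean_le (R : realType) (N : nat) (b : nat -> R[i]) (C : R) :
  (forall i, normc (b i) <= C) ->
  normc ((N.+1%:R^-1)%:C * \sum_(i < N.+1) b i) <= C.
Proof.
move=> bC; rewrite Normc.normcM normc_real ger0_norm ?invr_ge0//.
rewrite ler_pdivrMl// (le_trans (normc_sum _ b))//.
have : \sum_(i < N.+1) normc (b i) <= \sum_(i < N.+1) C by exact: ler_sum.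
by rewrite sumr_const card_ord mulr_natl.
Qed.

Lemma cesaro_powers_cvg0 (R : realType) (q : R[i]) : normc q = 1 -> q != 1 ->
  (fun N => normc ((N.+1%:R^-1)%:C * \sum_(i < N.+1) q ^+ i)) @ \oo --> (0 : R).
Proof.
move=> q1 qN1.
have q0 : 0 < normc (q - 1).
  rewrite lt_neqAle normc_ge0 andbT eq_sym; apply: contra qN1 => /eqP.
  by move=> /Normc.eq0_normc/subr0_eq ->.
have lim : 2 / normc (q - 1) * N.+1%:R^-1 @[N --> \oo] --> (0 : R).
  rewrite -(mulr0 (2 / normc (q - 1))).
  by apply: cvgMl_tmp; exact: cvg_harmonic.
apply: (squeeze_cvgr _ (cvg_cst 0) lim); apply: nearW => N.
rewrite normc_ge0/= Normc.normcM normc_real ger0_norm ?invr_ge0// mulrC.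
(* the geometric sum times [q - 1] is [q ^+ N.+1 - 1], of modulus at most 2 *)
rewrite ler_wpM2r ?invr_ge0// ler_pdivlMr// -Normc.normcM mulrC -subrX1.
rewrite (le_trans (normcD_le _ _))// normcX q1 expr1n -[X in normc X]mulN1r.
by rewrite mulr1 (_ : -1 = (-1)%:C) ?normc_real ?normrN1 ?rmorphN.
Qed.

(** * Almost orthogonal sequences in an inner product space *)

Section inner_product.
Context (R : realType) (V : lmodType R[i]) (dot : {dot V for @Num.conj R[i]}).
Implicit Types u v : V.

Let sqn u : R := cRe (dot u u).

Let dot_sqn u : dot u u = (sqn u)%:C.
Proof.
have : 0 <= dot u u by exact: dnorm_ge0.
by rewrite /sqn; case: (dot u u) => a b; rewrite lecE /= => /andP[/eqP->].
Qed.

Let sqn_ge0 u : 0 <= sqn u.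
Proof. by rewrite -lecR -dot_sqn; exact: dnorm_ge0. Qed.

(** Subtracting [t] times the component of [u] along [v] lowers the squared
    norm by [2 t |<u, v>|^2 - t^2 |<u, v>|^2 |v|^2], and [t |v|^2 <= 1]. *)
Lemma sqn_descent u v (s t : R) : sqn v <= s -> t = (s + 1)^-1 ->
  sqn (u - (t%:C * dot u v) *: v) <= sqn u - t * normc (dot u v) ^+ 2.
Proof.
move=> vs tE.
have s1 : 0 < s + 1 by rewrite (lt_le_trans ltr01)// lerDr (le_trans _ vs).
have t0 : 0 < t by rewrite tE invr_gt0.
have ts : t * sqn v <= 1.
  by rewrite tE mulrC ler_pdivrMr// mul1r (le_trans vs)// lerDl.
have -> : sqn (u - (t%:C * dot u v) *: v) =
    sqn u - 2 * t * normc (dot u v) ^+ 2 +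
      t ^+ 2 * normc (dot u v) ^+ 2 * sqn v.
  apply: (@complexI R).
  have nE : `|t%:C * dot u v| ^+ 2 = (t ^+ 2 * normc (dot u v) ^+ 2)%:C.
    rewrite normcE_norm Normc.normcM normc_real -rmorphXn exprMn.
    by rewrite real_normK ?num_real.
  rewrite -dot_sqn dnormB dnormZ /= !dot_sqn nE.
  have dE : dot u ((t%:C * dot u v) *: v) = (t * normc (dot u v) ^+ 2)%:C.
    rewrite linearZr_LR /=.
    rewrite [RHS]rmorphM /= normc_sqr_conj rmorphM /= conj_Creal ?complex_real//.
    by rewrite -mulrA [X in _ * X]mulrC.
  rewrite dE; simpc.
  by congr (_ +i* _); ring.
have n0 := sqr_ge0 (normc (dot u v)).
have := ler_wpM2l (mulr_ge0 (ltW t0) n0) ts.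
by rewrite mulr1; nra.
Qed.

Section almost_orthogonal.
Variables (x : nat -> V) (s : R).
Hypothesis x_le : forall j, sqn (x j) <= s.
Hypothesis x_orth : forall j k, (k < j)%N ->
  normc (dot (x k) (x j)) <= j.+1%:R^-1 ^+ 2.
Variable y : V.

Let t : R := (s + 1)^-1.

Let s1 : 0 < s + 1.
Proof. by rewrite (lt_le_trans ltr01)// lerDr (le_trans _ (x_le 0%N)). Qed.

Let t0 : 0 < t. Proof. by rewrite invr_gt0. Qed.

(** What is left of [y] after successively subtracting [t] times the
    components along [x 0], ..., [x m.-1]. The factor [t] replaces the division
    by the squared norm of [x n], which may vanish. *)
Fixpoint residual m : V :=
  if m is n.+1 then
    residual n - (t%:C * dot (residual n) (x n)) *: x n
  else y.

Let d m := dot (residual m) (x m).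

Let sqn_residualS m :
  sqn (residual m.+1) <= sqn (residual m) - t * normc (d m) ^+ 2.
Proof. exact: (@sqn_descent _ _ s). Qed.

Let sqn_residual_decr m : sqn (residual m.+1) <= sqn (residual m).
Proof.
by rewrite (le_trans (sqn_residualS m))// gerBl (mulr_ge0 (ltW t0) (sqr_ge0 _)).
Qed.

Let sqn_residual_le m : sqn (residual m) <= sqn y.
Proof. by elim: m => [//|m]; exact/le_trans/sqn_residual_decr. Qed.

(* [r <= 1 + r ^ 2] turns the bound on [|d m|^2] into one on [|d m|] *)
Let M : R := 1 + sqn y / t.

Let d_le m : normc (d m) <= M.
Proof.
have dy : normc (d m) ^+ 2 <= sqn y / t.
  rewrite ler_pdivlMr// mulrC (le_trans _ (sqn_residual_le m))//.
  by rewrite -subr_ge0 (le_trans _ (sqn_residualS m)).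
by rewrite /M; nra.
Qed.

Let d_cvg0 : (fun m => normc (d m)) @ \oo --> (0 : R).
Proof.
have nincr : nonincreasing_seq (fun m => sqn (residual m)).
  exact/nonincreasing_seqP.
have : cvgn (fun m => sqn (residual m)).
  apply: nonincreasing_is_cvgn => //.
  by exists 0 => _ [m _ <-]; exact: sqn_ge0.
move=> /cvg_ex[l sl].
have sSl : sqn (residual m.+1) @[m --> \oo] --> l.
  by rewrite (cvg_shiftS (fun m => sqn (residual m))).
have sql : t^-1 * (sqn (residual m) - sqn (residual m.+1)) @[m --> \oo] -->
    (0 : R).
  by rewrite -(mulr0 t^-1) -(subrr l); apply: cvgMl_tmp; exact: cvgB.
have dd : normc (d m) ^+ 2 @[m --> \oo] --> (0 : R).
  apply: (squeeze_cvgr _ (cvg_cst 0) sql); apply: nearW => m /=.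
  rewrite sqr_ge0 ler_pdivlMl//.
  by have := sqn_residualS m; rewrite /=; lra.
rewrite (_ : (fun m => _) = (fun m => Num.sqrt (normc (d m) ^+ 2))); last first.
  by apply/funext => m; rewrite sqrtr_sqr ger0_norm// normc_ge0.
rewrite -[X in _ --> X](@sqrtr0 R).
by apply: continuous_cvg dd; exact: sqrt_continuous.
Qed.

Let dot_residual m (z : V) :
  dot (residual m) z = dot y z - \sum_(j < m) t%:C * d j * dot (x j) z.
Proof.
elim: m => [|m ih]; first by rewrite big_ord0 subr0.
by rewrite big_ord_recr /= linearBl linearZl_LR/= ih opprD addrA.
Qed.

(** A bounded sequence whose inner products [<x k, x j>], [k < j], decay like
    [1 / (j + 1) ^ 2] converges weakly to zero. *)
Lemma almost_orthogonal_cvg0 : (fun m => normc (dot y (x m))) @ \oo --> (0 : R).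
Proof.
have bnd m : normc (dot y (x m)) <= normc (d m) + t * M * m.+1%:R^-1.
  have -> : dot y (x m) = d m + \sum_(j < m) t%:C * d j * dot (x j) (x m).
    by rewrite /d dot_residual subrK.
  rewrite (le_trans (normcD_le _ _))// lerD2l.
  rewrite (le_trans (normc_sum _ (fun j => t%:C * d j * dot (x j) (x m))))//.
  have M0 : 0 <= M by exact: le_trans (normc_ge0 _) (d_le 0).
  have tM0 : 0 <= t * M by rewrite mulr_ge0// ltW.
  have : \sum_(j < m) normc (t%:C * d j * dot (x j) (x m)) <=
      \sum_(j < m) t * M * m.+1%:R^-1 ^+ 2.
    apply: ler_sum => j _.
    rewrite !Normc.normcM normc_real (ger0_norm (ltW t0)).
    apply: ler_pM => //; rewrite ?mulr_ge0 ?normc_ge0// ?(ltW t0)//.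
      by rewrite ler_pM2l.
    exact: x_orth.
  move=> /le_trans; apply.
  (* there are [m] terms, and [m / (m + 1) ^ 2 <= 1 / (m + 1)] *)
  rewrite sumr_const card_ord -[leLHS]mulr_natl mulrCA ler_wpM2l//.
  by rewrite expr2 mulrA ger_pMl ?invr_gt0// ler_pdivrMr// mul1r ler_nat.
have lim : normc (d m) + t * M * m.+1%:R^-1 @[m --> \oo] --> (0 : R).
  rewrite -[X in _ --> X](addr0 (0 : R)); apply: cvgD; first exact: d_cvg0.
  rewrite -(mulr0 (t * M)); apply: cvgMl_tmp; exact: cvg_harmonic.
apply: (squeeze_cvgr _ (cvg_cst 0) lim); apply: nearW => m.
by rewrite normc_ge0 bnd.
Qed.

End almost_orthogonal.
End inner_product.

(** * A criterion for weak quasistability *)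

(** If the Cesaro means of a nonnegative sequence tend to zero, the sequence is
    small on a whole window [n - m, ..., n] of given length. Otherwise each
    block of [m.+1] consecutive terms but the first would contain a term at
    least [e], and the means at the ends of the blocks, from the second on,
    would be at least [e / (2 m.+1)]. *)
Lemma cesaro_cvg0_window (R : realType) (a : nat -> R) :
  (forall i, 0 <= a i) ->
  (fun N => N.+1%:R^-1 * \sum_(i < N.+1) a i) @ \oo --> (0 : R) ->
  forall m (e : R), 0 < e ->
    exists2 n, (m < n)%N & forall k, (k <= m)%N -> a (n - k)%N < e.
Proof.
move=> a0 acvg m e e0; apply: contrapT => nex.
have big n : (m < n)%N -> exists2 k, (k <= m)%N & e <= a (n - k)%N.
  move=> mn; apply: contrapT => nk; apply: nex; exists n => // k km.
  by rewrite ltNge; apply/negP => ek; apply: nk; exists k.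
have block Q : Q%:R * e <= \sum_(i < Q.+1 * m.+1) a i.
  elim: Q => [|Q ih]; first by rewrite mul0r sumr_ge0.
  rewrite (mulSnr Q.+1) big_split_ord /= -natr1 mulrDl mul1r lerD//.
  have [|k km ek] := big (Q.+1 * m.+1 + m)%N.
    by rewrite mulSn -addnA leq_addr.
  have mk : (m - k < m.+1)%N by rewrite ltnS leq_subr.
  rewrite (bigD1 (Ordinal mk))//= addnBA// (le_trans ek)// lerDl.
  by rewrite sumr_ge0.
have e'0 : 0 < e / (2 * m.+1%:R) by rewrite divr_gt0// mulr_gt0.
have /cvgrPdist_lt/(_ _ e'0)[N0 _ NP] := acvg.
(* the mean is taken over the first [N0.+2] blocks *)
have [L LE] : exists L, L.+1 = (N0.+2 * m.+1)%N by exists (N0.+2 * m.+1).-1.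
have /NP/= : (N0 <= L)%N by rewrite -ltnS LE mulnS ltn_addr.
rewrite sub0r normrN ger0_norm; last by rewrite mulr_ge0// sumr_ge0.
rewrite ltNge => /negP; apply.
rewrite [leRHS]mulrC ler_pdivlMr// LE; apply: le_trans (block N0.+1).
have -> : e / (2 * m.+1%:R) * (N0.+2 * m.+1)%:R = e * N0.+2%:R / 2.
  by rewrite natrM; field; rewrite ?pnatr_eq0.
rewrite -natr1 -[in leRHS]natr1.
by have : 0 <= N0%:R :> R by []; nra.
Qed.

Section quasistability_criterion.
Context (R : realType) (V : lmodType R[i]) (dot : {dot V for @Num.conj R[i]}).
Variable T : {linear V -> V}.
Hypothesis T_isometry : forall u v, dot (T u) (T v) = dot u v.
Hypothesis T_cesaro : forall u,
  (fun N => N.+1%:R^-1 * \sum_(i < N.+1) normc (dot (iter i T u) u) ^+ 2) @ \oo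
    --> (0 : R).

Let dot_iter n u v : dot (iter n T u) (iter n T v) = dot u v.
Proof. by elim: n => [//|n ih] /=; rewrite T_isometry. Qed.

(** An isometry is weakly quasistable as soon as the Cesaro means of
    [|<T^i u, u>|^2] tend to zero for every [u]. *)
Lemma weakly_quasistable_isometry : weakly_quasistable dot T.
Proof.
move=> x; pose a i := normc (dot (iter i T x) x) ^+ 2.
(* squared, as [a] is the square of a modulus *)
pose tol j : R := (j.+1%:R^-1 ^+ 2) ^+ 2.
have tol0 j : 0 < tol j by rewrite !exprn_gt0// invr_gt0.
have a0 i : 0 <= a i by exact: sqr_ge0.
have step (p : nat * nat) : exists n, (p.1 < n)%N /\
    forall k, (k <= p.1)%N -> a (n - k)%N < tol p.2.
  have [n ? ?] := cesaro_cvg0_window a0 (T_cesaro x) p.1 (tol0 p.2).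
  by exists n.
have [f fP] := choice step.
(* the next exponent is [f] of the present one and of its own index *)
pose n := fix n j := if j is i.+1 then f (n i, i.+1) else 1%N.
have nS j : (n j < n j.+1)%N by have [] := fP (n j, j.+1).
have nhomo : {homo n : i j / (i < j)%N} by exact: homo_ltn ltn_trans nS.
have nhomo_le : {homo n : i j / (i <= j)%N} by exact: ltW_homo.
exists n; split=> //.
  by case=> // j; exact: leq_ltn_trans (nS j).
move=> y; pose z j := iter (n j) T x.
have zle j : cRe (dot (z j) (z j)) <= cRe (dot x x).
  by rewrite /z dot_iter.
have zorth j k : (k < j)%N -> normc (dot (z k) (z j)) <= j.+1%:R^-1 ^+ 2.
  case: j => // j kj; have nkj : (n k <= n j)%N by exact: nhomo_le.
  have [_ /(_ _ nkj) /=] := fP (n j, j.+1).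
  rewrite -[f _]/(n j.+1) /a /tol ltr_pXn2r// ?nnegrE ?normc_ge0 ?sqr_ge0//.
  rewrite /z -(dot_iter (n k)) -iterD subnKC; last first.
    exact: leq_trans nkj (ltnW (nS j)).
  by rewrite hermC expr0 mul1r normc_conj => /ltW.
have /cvgrPdist_lt yz := almost_orthogonal_cvg0 zle zorth y.
(* a positive element of [R[i]] is a positive real *)
apply/cvgrPdist_lt => -[e e'].
rewrite ltcE /= => /andP[/eqP-> e0].
apply: filterS (yz _ e0) => j /=.
rewrite !sub0r !normrN normr_id hermC expr0 mul1r normcE_norm normc_conj ltcR.
by rewrite ger0_norm ?normc_ge0.
Qed.

End quasistability_criterion.

(** * Integrals of bounded complex functions against a density *)

Section cmeasurable_functions.
Context d (T : measurableType d) (R : realType).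
Implicit Types f g : T -> R[i].

Lemma cmeasurable_sum n (h : nat -> T -> R[i]) :
  (forall i, cmeasurable (h i)) -> cmeasurable (fun x => \sum_(i < n) h i x).
Proof.
move=> mh; split.
  under eq_fun do rewrite raddf_sum.
  by apply: measurable_sum => i; case: (mh i).
under eq_fun do rewrite raddf_sum.
by apply: measurable_sum => i; case: (mh i).
Qed.

Lemma cmeasurableM f g :
  cmeasurable f -> cmeasurable g -> cmeasurable (fun x => f x * g x).
Proof.
move=> [fr fi] [gr gi]; split.
  rewrite (_ : (fun _ => _) =
      fun x => cRe (f x) * cRe (g x) - cIm (f x) * cIm (g x)).
    by apply: measurable_funB; exact: measurable_funM.
  by apply/funext => x; case: (f x) (g x) => [? ?] [? ?].
rewrite (_ : (fun _ => _) =
    fun x => cRe (f x) * cIm (g x) + cIm (f x) * cRe (g x)).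
  by apply: measurable_funD; exact: measurable_funM.
by apply/funext => x; case: (f x) (g x) => [? ?] [? ?].
Qed.

Lemma cmeasurable_cst (c : R[i]) : cmeasurable (fun _ : T => c).
Proof. by split; exact: measurable_cst. Qed.

Lemma cmeasurableX f n :
  cmeasurable f -> cmeasurable (fun x => f x ^+ n).
Proof.
move=> mf; elim: n => [|n ih]; first exact: cmeasurable_cst.
by under eq_fun do rewrite exprS; exact: cmeasurableM.
Qed.

Lemma cmeasurable_conj f :
  cmeasurable f -> cmeasurable (fun x => (f x)^*).
Proof.
move=> [fr fi]; split.
  by rewrite (_ : (fun _ => _) = fun x => cRe (f x))//;
    apply/funext => x; case: (f x).
rewrite (_ : (fun _ => _) = fun x => - cIm (f x)); first exact: measurableT_comp.
by apply/funext => x; case: (f x).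
Qed.

End cmeasurable_functions.

Section weighted_integral.
Context d (T : measurableType d) (R : realType).
Variable mu : {measure set T -> \bar R}.
Variable w : T -> R.
Hypothesis w_ge0 : forall x, 0 <= w x.
Hypothesis w_int : mu.-integrable setT (EFin \o w).

Let mw : measurable_fun setT w.
Proof. by apply/measurable_EFinP; case/integrableP: w_int. Qed.

(* dominated convergence for the real and imaginary parts *)
Let Rintegral_cvg0 (h : nat -> T -> R) (C : R) :
  (forall n, measurable_fun setT (h n)) ->
  (forall n x, `|h n x| <= C) ->
  {ae mu, forall x, (fun n => h n x) @ \oo --> (0 : R)} ->
  (fun n => (\int[mu]_x (h n x * w x))%R) @ \oo --> (0 : R).
Proof.
move=> mh hC h0.
have [] := @dominated_convergence _ _ _ mu setT measurableT
  (fun n x => (h n x * w x)%:E) (cst 0%E) (fun x => (C * w x)%:E).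
- by move=> n; apply/measurable_EFinP; exact: measurable_funM.
- exact: measurable_cst.
- apply: filterS h0 => x hx _; apply: cvg_EFin; first exact: nearW.
  by rewrite -(mul0r (w x)); apply: cvgMr_tmp.
- by under eq_fun do rewrite EFinM; exact: integrableZl.
- apply: aeW => x n _; rewrite lee_fin normrM (ger0_norm (w_ge0 x)).
  by rewrite ler_wpM2r.
move=> _ _; rewrite integral0 => /fine_cvg; exact.
Qed.

Let integrable_weight (h : T -> R) (C : R) :
  measurable_fun setT h -> (forall x, `|h x| <= C) ->
  mu.-integrable setT (fun x => (h x * w x)%:E).
Proof.
move=> mh hC.
apply: (@le_integrable _ _ _ mu setT measurableT _ (fun x => (C * w x)%:E)).
- by apply/measurable_EFinP; exact: measurable_funM.
- move=> x _; rewrite !abse_EFin lee_fin !normrM (ger0_norm (w_ge0 x)).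
  by rewrite ler_wpM2r// (le_trans (hC x))// ler_norm.
by under eq_fun do rewrite EFinM; exact: integrableZl.
Qed.

Let cRe_weight (h : T -> R[i]) x : cRe (h x * (w x)%:C) = cRe (h x) * w x.
Proof. by case: (h x) => a b /=; rewrite mulr0 subr0. Qed.

Let cIm_weight (h : T -> R[i]) x : cIm (h x * (w x)%:C) = cIm (h x) * w x.
Proof. by case: (h x) => a b /=; rewrite mulr0 add0r. Qed.

Lemma cintegrable_weight (h : T -> R[i]) (C : R) :
  cmeasurable h -> (forall x, normc (h x) <= C) ->
  cintegrable mu (fun x => h x * (w x)%:C).
Proof.
move=> [hr hi] hC; split.
  under eq_fun do rewrite cRe_weight.
  by apply: (@integrable_weight _ C) => // x; exact: le_trans (norm_Re_le _) _.
under eq_fun do rewrite cIm_weight.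
by apply: (@integrable_weight _ C) => // x; exact: le_trans (norm_Im_le _) _.
Qed.

(** The factor 2 comes from bounding the real and imaginary parts
    separately. *)
Lemma normc_cintegral_weight_le (h : T -> R[i]) (C : R) :
  cmeasurable h -> (forall x, normc (h x) <= C) ->
  normc (cintegral mu (fun x => h x * (w x)%:C)) <=
    2 * (C * (\int[mu]_x w x)%R).
Proof.
move=> [hr hi] hC; rewrite (le_trans (normc_le_ReIm _))//= mulr_natl mulr2n.
have bnd (g : T -> R) : measurable_fun setT g -> (forall x, `|g x| <= C) ->
    `|(\int[mu]_x (g x * w x))%R| <= C * (\int[mu]_x w x)%R.
  move=> mg gC; have gi := integrable_weight mg gC.
  rewrite (le_trans (le_normr_Rintegral _ _))// -RintegralZl//.
  apply: le_Rintegral => //.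
  - exact: integrable_norm gi.
  - exact: (integrableZl measurableT C w_int).
  - by move=> x _; rewrite normrM (ger0_norm (w_ge0 x)) ler_wpM2r.
apply: lerD.
  under eq_Rintegral do rewrite cRe_weight.
  by apply: bnd => // x; exact: le_trans (norm_Re_le _) _.
under eq_Rintegral do rewrite cIm_weight.
by apply: bnd => // x; exact: le_trans (norm_Im_le _) _.
Qed.

Lemma cintegral_weight_linear n (a : R[i]) (b : nat -> R[i]) (h : nat -> T -> R[i])
    (C : R) :
  (forall i, cmeasurable (h i)) -> (forall i x, normc (h i x) <= C) ->
  cintegral mu (fun x => (a * \sum_(i < n) b i * h i x) * (w x)%:C) =
  a * \sum_(i < n) b i * cintegral mu (fun x => h i x * (w x)%:C).
Proof.
move=> mh hC.
have ih i : cintegrable mu (fun x => h i x * (w x)%:C).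
  exact: (@cintegrable_weight _ C).
have ib i : cintegrable mu (fun x => b i * (h i x * (w x)%:C)).
  under eq_fun do rewrite mulrA.
  apply: (@cintegrable_weight _ (normc (b i) * C)) => [|x].
    by apply: cmeasurableM => //; exact: cmeasurable_cst.
  by rewrite Normc.normcM ler_wpM2l// normc_ge0.
have isum k : cintegrable mu (fun x => (\sum_(i < k) b i * h i x) * (w x)%:C).
  apply: (@cintegrable_weight _ (\sum_(i < k) normc (b i) * C)) => [|x].
    apply: (@cmeasurable_sum _ _ _ k (fun i x => b i * h i x)) => i.
    by apply: cmeasurableM => //; exact: cmeasurable_cst.
  rewrite (le_trans (normc_sum _ (fun i => b i * h i x)))// ler_sum// => i _.
  by rewrite Normc.normcM ler_wpM2l// normc_ge0.
under eq_fun do rewrite -mulrA.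
rewrite cintegralZ//; congr (a * _).
elim: n => [|n ihn].
  under eq_fun do rewrite big_ord0 mul0r.
  by rewrite big_ord0 /cintegral /Rintegral/= !integral0.
under eq_fun do rewrite big_ord_recr /= mulrDl -[b n * _ * _]mulrA.
by rewrite (cintegralD (isum n) (ib n)) ihn cintegralZ// big_ord_recr.
Qed.

(** Dominated convergence for uniformly bounded complex functions. *)
Lemma cintegral_weight_cvg0 (h : nat -> T -> R[i]) (C : R) :
  (forall n, cmeasurable (h n)) ->
  (forall n x, normc (h n x) <= C) ->
  {ae mu, forall x, (fun n => normc (h n x)) @ \oo --> (0 : R)} ->
  (fun n => normc (cintegral mu (fun x => h n x * (w x)%:C))) @ \oo --> (0 : R).
Proof.
move=> mh hC h0.
have part (p : R[i] -> R) : (forall z, `|p z| <= normc z) ->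
    (forall n, measurable_fun setT (fun x => p (h n x))) ->
    (fun n => `|(\int[mu]_x (p (h n x) * w x))%R|) @ \oo --> (0 : R).
  move=> ple mp; rewrite -[X in _ --> X](@normr0 _ R); apply: cvg_norm.
  apply: (@Rintegral_cvg0 _ C) => // [n x|]; first exact: le_trans (ple _) _.
  apply: filterS h0 => x hx; apply/norm_cvg0P.
  apply: (squeeze_cvgr _ (cvg_cst 0) hx); apply: nearW => n.
  by rewrite normr_ge0 ple.
have lim : `|(\int[mu]_x (cRe (h n x) * w x))%R| +
    `|(\int[mu]_x (cIm (h n x) * w x))%R| @[n --> \oo] --> (0 : R).
  rewrite -[X in _ --> X](addr0 (0 : R)); apply: cvgD.
    by apply: part => [|n]; [exact: norm_Re_le|case: (mh n)].
  by apply: part => [|n]; [exact: norm_Im_le|case: (mh n)].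
apply: (squeeze_cvgr _ (cvg_cst 0) lim); apply: nearW => n.
rewrite normc_ge0 (le_trans (normc_le_ReIm _))//= lerD//.
  by under eq_Rintegral do rewrite cRe_weight.
by under eq_Rintegral do rewrite cIm_weight.
Qed.

End weighted_integral.

(** * Wiener's lemma on the circle *)

Lemma measurable_circle1 (R : realType) (v : circle R) : measurable [set v].
Proof.
have [mr mi] := cmeasurable_circle_val R.
rewrite (_ : [set v] =
  (fun z => cRe (circle_val z)) @^-1` [set cRe (circle_val v)] `&`
  (fun z => cIm (circle_val z)) @^-1` [set cIm (circle_val v)]).
  by apply: measurableI; rewrite -[X in measurable X]setTI;
    [apply: mr|apply: mi].
apply/seteqP; split=> [z ->//|z [/= rz iz]]; apply: val_inj.
rewrite -/(circle_val z) -/(circle_val v).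
by case: (circle_val z) (circle_val v) rz iz => [? ?] [? ?] /= -> ->.
Qed.

Section wiener.
Context (R : realType) (mu : {measure set (circle R) -> \bar R}).
Hypothesis mu_cont : continuous_measure mu.
Variable w : circle R -> R.
Hypothesis w_ge0 : forall x, 0 <= w x.
Hypothesis w_int : mu.-integrable setT (EFin \o w).

(** The Fourier coefficients of the measure with density [w]. *)
Let c i : R[i] := cintegral mu (fun z => circle_val z ^+ i * (w z)%:C).

Let normcX_circle i (z : circle R) : normc (circle_val z ^+ i) = 1.
Proof. by rewrite normcX circle_val_norm expr1n. Qed.

(** The mean of the powers [(v^* z)^i], [i <= N]. *)
Let K N (v z : circle R) : R[i] :=
  (N.+1%:R^-1)%:C * \sum_(i < N.+1) ((circle_val v)^* ^+ i) * circle_val z ^+ i.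

Let ae_neq v : {ae mu, forall z, z <> v}.
Proof.
exists [set v]; split; [exact: measurable_circle1|exact: mu_cont|].
by move=> z /contrapT.
Qed.

Let K_cvg0 v : {ae mu, forall z, (fun N => normc (K N v z)) @ \oo --> (0 : R)}.
Proof.
apply: filterS (ae_neq v) => z zv; rewrite /K.
under eq_fun do under eq_bigr do rewrite -exprMn.
apply: cesaro_powers_cvg0.
  by rewrite Normc.normcM normc_conj !circle_val_norm mulr1.
apply: contra_notN zv => /eqP/(congr1 ( *%R (circle_val v))).
(* [v^* z = 1] gives [z = v], because [v v^* = 1] *)
rewrite mulrA -normc_sqr_conj circle_val_norm expr1n mul1r mulr1.
exact: val_inj.
Qed.

(** The integral of [K N v] against the measure with density [w]; it tends to
    the mass of the point [v], that is, to 0. *)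
Let G N v := cintegral mu (fun z => K N v z * (w z)%:C).

Let measurable_circleX i : cmeasurable (fun z : circle R => circle_val z ^+ i).
Proof. by apply: cmeasurableX; exact: cmeasurable_circle_val. Qed.

Let K_le N v z : normc (K N v z) <= 1.
Proof.
rewrite /K; under eq_bigr do rewrite -exprMn.
apply: (@normc_mean_le _ N
  (fun i => ((circle_val v)^* * circle_val z) ^+ i)) => i.
by rewrite normcX Normc.normcM normc_conj !circle_val_norm mulr1 expr1n.
Qed.

Let measurable_K N v : cmeasurable (K N v).
Proof.
apply: cmeasurableM; first exact: cmeasurable_cst.
apply: (@cmeasurable_sum _ _ _ N.+1
  (fun i z => (circle_val v)^* ^+ i * circle_val z ^+ i)) => i.
by apply: cmeasurableM => //; exact: cmeasurable_cst.
Qed.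

Let G_cvg0 v : (fun N => normc (G N v)) @ \oo --> (0 : R).
Proof.
by apply: (cintegral_weight_cvg0 w_ge0 w_int (C := 1)); last exact: K_cvg0.
Qed.

Let G_le N v : normc (G N v) <= 2 * (1 * (\int[mu]_x w x)%R).
Proof. exact: normc_cintegral_weight_le. Qed.

Let GE N v : G N v =
  (N.+1%:R^-1)%:C * \sum_(i < N.+1) c i * (circle_val v)^* ^+ i.
Proof.
rewrite /G /K (@cintegral_weight_linear _ _ _ mu w w_ge0 w_int N.+1 _
  (fun i => (circle_val v)^* ^+ i) (fun i z => circle_val z ^+ i) 1) => //.
  by congr (_ * _); apply: eq_bigr => i _; rewrite mulrC.
by move=> i x; rewrite normcX_circle.
Qed.

Let measurable_conjX i : cmeasurable (fun z : circle R => (circle_val z)^* ^+ i).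
Proof.
by apply: cmeasurableX; apply: cmeasurable_conj; exact: cmeasurable_circle_val.
Qed.

Let conjX_norm i (z : circle R) : normc ((circle_val z)^* ^+ i) = 1.
Proof. by rewrite normcX normc_conj circle_val_norm expr1n. Qed.

Let c_conj i :
  cintegral mu (fun z => (circle_val z)^* ^+ i * (w z)%:C) = (c i)^*.
Proof.
rewrite /c -cintegral_conj; last first.
  by apply: (cintegrable_weight w_ge0 w_int (C := 1)) => // x;
    rewrite normcX_circle.
congr cintegral; apply/funext => z.
rewrite rmorphM rmorphXn /=; congr (_ * _).
by rewrite oppr0.
Qed.

Let G_int N : cintegral mu (fun v => G N v * (w v)%:C) =
  (N.+1%:R^-1 * \sum_(i < N.+1) normc (c i) ^+ 2)%:C.
Proof.
under eq_fun do rewrite GE.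
rewrite (@cintegral_weight_linear _ _ _ mu w w_ge0 w_int N.+1 _
  c (fun i z => (circle_val z)^* ^+ i) 1) => //; last first.
  by move=> i x; rewrite conjX_norm.
rewrite rmorphM rmorph_sum /=; congr (_ * _); apply: eq_bigr => i _.
by rewrite c_conj; exact: esym (normc_sqr_conj _).
Qed.

(** Wiener's lemma: the Cesaro means of the squared moduli of the Fourier
    coefficients of a finite continuous measure tend to zero. *)
Lemma wiener_cvg0 :
  (fun N => N.+1%:R^-1 * \sum_(i < N.+1) normc (c i) ^+ 2) @ \oo --> (0 : R).
Proof.
have mG N : cmeasurable (G N).
  rewrite (_ : G N = fun v => (N.+1%:R^-1)%:C *
    \sum_(i < N.+1) c i * (circle_val v)^* ^+ i); last exact/funext/GE.
  apply: cmeasurableM; first exact: cmeasurable_cst.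
  apply: (@cmeasurable_sum _ _ _ N.+1 (fun i v => c i * (circle_val v)^* ^+ i)) => i.
  by apply: cmeasurableM => //; exact: cmeasurable_cst.
have := cintegral_weight_cvg0 w_ge0 w_int mG G_le (aeW _ G_cvg0).
have GN N : normc (cintegral mu (fun v => G N v * (w v)%:C)) =
    N.+1%:R^-1 * \sum_(i < N.+1) normc (c i) ^+ 2.
  rewrite G_int normc_real ger0_norm// mulr_ge0// sumr_ge0// => i _.
  exact: sqr_ge0.
by under eq_fun do rewrite GN.
Qed.

End wiener.

(** * Powers of the position operator *)

Section position.
Context (R : realType) (mu : {measure set (circle R) -> \bar R}).

Lemma iter_position_opE n (u : L2 mu) :
  {ae mu, forall z,
    repr (iter n (position_op mu) u) z = circle_val z ^+ n * repr u z}.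
Proof.
elim: n => [|n ih]; first by apply: aeW => z; rewrite mul1r.
have := position_opE (iter n (position_op mu) u).
by apply: filterS2 ih => z zn; rewrite iterS => ->; rewrite zn mulrA -exprS.
Qed.

Lemma normc_sqr_integrable (u : L2 mu) :
  mu.-integrable setT (EFin \o (fun z => normc (repr u z) ^+ 2)).
Proof.
have := cintegrable_L2 (repr u) (repr u).
move=> -[+ _]; apply: eq_integrable => // z _ /=.
by rewrite -[_ * _]normc_sqr_conj.
Qed.

Lemma L2dot_iter_position n (u : L2 mu) :
  L2dot mu (iter n (position_op mu) u) u =
  cintegral mu (fun z => circle_val z ^+ n * (normc (repr u z) ^+ 2)%:C).
Proof.
apply: ae_eq_cintegral; first exact: cintegrable_L2.
  apply: (cintegrable_weight _ (normc_sqr_integrable u) (C := 1)) => [z||z].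
  - exact: sqr_ge0.
  - by apply: cmeasurableX; exact: cmeasurable_circle_val.
  - by rewrite normcX circle_val_norm expr1n.
have := iter_position_opE n u; apply: filterS => z ->.
by rewrite normc_sqr_conj mulrA.
Qed.

End position.

Theorem theorem7p3 (R : realType)
  (mu : {finite_measure set (circle R) -> \bar R}) :
  continuous_measure mu -> weakly_quasistable (L2dot mu) (position_op mu).
Proof.
move=> mu_cont; apply: weakly_quasistable_isometry => [u v|u].
  exact: position_op_isometry.
have w_ge0 z : 0 <= normc (repr u z) ^+ 2 by exact: sqr_ge0.
have := wiener_cvg0 mu_cont w_ge0 (normc_sqr_integrable u).
by under eq_fun do under eq_bigr do rewrite -L2dot_iter_position.
Qed.
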